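(* Suppose that the constants $p$, $q$ and $C$ satisfy $1\le p<q<\infty$ and $C>0$. Let $E$ be a normed $C$-interpolation space with respect to the couple $(\ell^{p},\ell^{q})$. Then $E$ has property $S_{q}(C)$.
   Context: All linear spaces are over a base field which is either $\mathbb{R}$ or $\mathbb{C}$ (the result is asserted for each of the two fields). Sequences are indexed by $\mathbb{N}=\{1,2,\dots\}$. A normed sequence space is a linear space $E\neq\{0\}$ of scalar sequences equipped with a norm $\|\cdot\|_E$; it is not assumed to be complete, and set inclusions between spaces are not assumed to be continuous. For a bounded scalar sequence $\{x_n\}_{n\in\mathbb{N}}$, $\{x_n^*\}_{n\in\mathbb{N}}$ denotes its nonincreasing rearrangement, $x_n^*=\inf\{\lambda\ge 0 : \#\{k:|x_k|>\lambda\}\le n-1\}$. Property $S_q(C)$ (for $q\in[1,\infty)$ and $C>0$): $E$ has property $S_q(C)$ if, whenever $\{u_n\}$ and $\{v_n\}$ are two sequences in $\ell^q$ satisfying $\sum_{n=1}^N (u_n^* )^q\le\sum_{n=1}^N (v_n^* )^q$ for all $N\in\mathbb{N}$ and $\sum_{n=1}^\infty (u_n^* )^q=\sum_{n=1}^\infty (v_n^* )^q$, and $\{u_n\}\in E$, it follows that $\{v_n\}\in E$ and $\|\{v_n\}\|_E\le C\|\{u_n\}\|_E$. For a Banach couple $(A_0,A_1)$, $\mathcal{L}_1((A_0,A_1))$ denotes the set of all linear maps $T:A_0+A_1\to A_0+A_1$ such that, for $j=0,1$, $T(A_j)\subset A_j$ and $\|Ta\|_{A_j}\le\|a\|_{A_j}$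 for all $a\in A_j$. A normed space $A\neq\{0\}$ contained in $A_0+A_1$ is a normed $C$-interpolation space with respect to $(A_0,A_1)$ if every $T\in\mathcal{L}_1((A_0,A_1))$ satisfies $T(A)\subset A$ and $\|Ta\|_A\le C\|a\|_A$ for all $a\in A$. *)

(* Defs.v *)
From HB Require Import structures.
From mathcomp Require Import all_boot all_order all_algebra.
From mathcomp Require Import all_classical all_reals all_analysis.
From mathcomp Require Import complex.
Set Implicit Arguments.
Unset Strict Implicit.
Unset Printing Implicit Defensive.
Import Order.TTheory GRing.Theory Num.Theory.
Local Open Scope classical_set_scope.
Local Open Scope ring_scope.

Inductive base_field := RealScalars | ComplexScalars.

Definition scalars (R : realType) (fld : base_field) : numFieldType :=
  match fld with
  | RealScalars => R
  | ComplexScalars => R[i]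
  end.

(* The norm of R[i] as a numFieldType takes its values in R[i]; modulus is
   its R-valued version. *)
Definition modulus (R : realType) (fld : base_field) : scalars R fld -> R :=
  match fld return scalars R fld -> R with
  | RealScalars => fun x : R => `|x|
  | ComplexScalars => fun z : R[i] => ComplexField.Normc.normc z
  end.
Arguments modulus {R fld} _.

(* The sequence {x_n}, n = 1, 2, ..., is encoded as k |-> x_(k+1). The scalars
   are seen as a module over themselves so that sequences form an lmodType. *)
Definition scalar_seq (R : realType) (fld : base_field) :
  lmodType (scalars R fld) := (nat -> (scalars R fld)^o).

Section normed_spaces.
Variables (R : realType) (fld : base_field) (V : lmodType (scalars R fld)).

(* A subset of V and a function on V of which only the values on that subset
   are meaningful; the axioms are in [is_normed_space]. *)
Record normed_data := NormedData {
  carrier : set V;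
  norm : V -> R }.

Definition is_normed_space (A : normed_data) : Prop :=
  [/\ [/\ carrier A 0,
          forall x y, carrier A x -> carrier A y -> carrier A (x + y) &
          forall a x, carrier A x -> carrier A (a *: x)],
      forall x, carrier A x -> 0 <= norm A x,
      forall x, carrier A x -> norm A x = 0 -> x = 0,
      forall a x, carrier A x -> norm A (a *: x) = modulus a * norm A x &
      forall x y, carrier A x -> carrier A y ->
        norm A (x + y) <= norm A x + norm A y].

Definition nonzero_space (A : normed_data) : Prop :=
  exists2 x, carrier A x & x != 0.

Definition sum_space (A0 A1 : normed_data) : set V :=
  [set a0 + a1 | a0 in carrier A0 & a1 in carrier A1].

Definition contracts (T : V -> V) (C : R) (A : normed_data) : Prop :=
  forall a, carrier A a -> carrier A (T a) /\ norm A (T a) <= C * norm A a.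

(* A linear map of A0 + A1 into itself is a function on V whose values outside
   A0 + A1 are irrelevant. *)
Definition L1 (A0 A1 : normed_data) (T : V -> V) : Prop :=
  [/\ forall x, sum_space A0 A1 x -> sum_space A0 A1 (T x),
      forall a x y, sum_space A0 A1 x -> sum_space A0 A1 y ->
        T (a *: x + y) = a *: T x + T y,
      contracts T 1 A0 &
      contracts T 1 A1].

Definition normed_interpolation_space (C : R) (A0 A1 A : normed_data) : Prop :=
  [/\ is_normed_space A,
      nonzero_space A,
      carrier A `<=` sum_space A0 A1 &
      forall T, L1 A0 A1 T -> contracts T C A].

End normed_spaces.

Section sequence_spaces.
Variables (R : realType) (fld : base_field).
Implicit Types (x u v : scalar_seq R fld) (p q C : R).

Definition ell p : normed_data (scalar_seq R fld) :=
  {| carrier := [set x : scalar_seq R fld |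
      (\sum_(0 <= k <oo) (@modulus R fld (x k) `^ p)%:E < +oo)%E];
     norm := fun x =>
       fine (\sum_(0 <= k <oo) (@modulus R fld (x k) `^ p)%:E)%E `^ p^-1 |}.

(* [rearrangement x n] is x^*_(n+1), whence the bound n on the cardinality. *)
Definition rearrangement x (n : nat) : R :=
  inf [set l : R | 0 <= l /\ ([set k | l < @modulus R fld (x k)] #<= `I_n)%card].

Definition property_S q C (E : normed_data (scalar_seq R fld)) : Prop :=
  forall u v,
    carrier (ell q) u -> carrier (ell q) v ->
    (forall N : nat, \sum_(n < N) rearrangement u n `^ q <=
                     \sum_(n < N) rearrangement v n `^ q) ->
    (\sum_(0 <= n <oo) (rearrangement u n `^ q)%:E =
     \sum_(0 <= n <oo) (rearrangement v n `^ q)%:E)%E ->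
    carrier E u ->
    carrier E v /\ norm E v <= C * norm E u.

End sequence_spaces.
Arguments ell {R fld} p.

(* Main.v *)
(* Put a = |u|^q and b = |v|^q. A doubly substochastic matrix m with
   a_n = sum_k m_(nk) b_k yields the linear map
   (T x)_k = v_k sum_n m_(nk) x_n / u_n. Jensen's inequality along the columns
   of m, then along its rows, shows that T is a contraction of l^s for every
   s in [1, q]. Since a and b have the same total mass, the columns of m with
   b_k > 0 sum to 1, so that T u = v and the interpolation property applies.

   The matrix is built greedily from the nonincreasing rearrangements. If
   b_k >= a_0 > b_(k+1), write a_0 as a convex combination
   t b_k + (1 - t) b_(k+1) and replace b_k and b_(k+1) by the complementary
   combination (1 - t) b_k + t b_(k+1): the new sequence is nonincreasing and
   still dominates the partial sums of a_1, a_2, ... Each step fixes one row of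
   m, so no limit is needed. *)
Require Import Defs.
From mathcomp Require Import all_boot all_order all_algebra.
From mathcomp Require Import all_classical all_reals all_analysis.
From mathcomp Require Import finmap complex ring lra.
Set Implicit Arguments.
Unset Strict Implicit.
Unset Printing Implicit Defensive.
Import Order.TTheory GRing.Theory Num.Theory.
Import numFieldNormedType.Exports.
Local Open Scope ring_scope.

(** * Convexity of powers and nonnegative sums *)

(** Convexity: the graph of y^q lies above its tangent at s. This is Young's inequality for y and
    s^(q-1) with exponents q and q/(q-1), so q = 1 is treated apart. *)
Lemma powR_tangent (R : realType) (q s y : R) :
  1 <= q -> 0 <= s -> 0 <= y ->
  q * s `^ (q - 1) * y <= y `^ q + (q - 1) * s `^ q.
Proof.
rewrite le_eqVlt => /predU1P[<-|q1] s0 y0.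
  by rewrite subrr powRr0 mul0r addr0 !mul1r powRr1.
have q0 : 0 < q by lra.
have q10 : 0 < q - 1 by lra.
have := @conjugate_powR R y (s `^ (q - 1)) q (q / (q - 1)) y0 (powR_ge0 _ _)
  q0 (divr_gt0 q0 q10).
have -> : q^-1 + (q / (q - 1))^-1 = 1 by field; rewrite !gt_eqF.
move=> /(_ erefl); rewrite -powRrM.
have -> : (q - 1) * (q / (q - 1)) = q by field; rewrite !gt_eqF.
rewrite -(ler_pM2l q0) => H.
rewrite -mulrA (mulrC _ y); apply: (le_trans H).
rewrite le_eqVlt; apply/orP; left; apply/eqP; field.
by rewrite !gt_eqF.
Qed.

(** Sum the tangent inequalities at the weighted mean s. A total weight below 1 is harmless because
    (q-1) s^q is nonnegative. *)
Lemma powR_jensen (R : realType) (q : R) (n : nat) (m y : nat -> R) :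
  1 <= q -> (forall i, 0 <= m i) -> (forall i, 0 <= y i) ->
  \sum_(i < n) m i <= 1 ->
  (\sum_(i < n) m i * y i) `^ q <= \sum_(i < n) m i * y i `^ q.
Proof.
move=> q1 m0 y0 m1; set s := \sum_(i < n) m i * y i.
have s0 : 0 <= s by apply: sumr_ge0 => i _; rewrite mulr_ge0.
have q0 : 0 < q by lra.
have sE : s * s `^ (q - 1) = s `^ q by exact: mulr_powRB1.
have H : \sum_(i < n) m i * (q * s `^ (q - 1) * y i)
    <= \sum_(i < n) m i * (y i `^ q + (q - 1) * s `^ q).
  by apply: ler_sum => i _; rewrite ler_wpM2l// powR_tangent.
move: H; under eq_bigr do rewrite mulrCA.
rewrite -mulr_sumr -/s -mulrA (mulrC _ s) sE.
under [X in _ <= X]eq_bigr do rewrite mulrDr.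
rewrite big_split/= -mulr_suml => H.
have : (\sum_(i < n) m i) * ((q - 1) * s `^ q) <= 1 * ((q - 1) * s `^ q).
  by rewrite ler_wpM2r// mulr_ge0 ?powR_ge0//; lra.
by move: H; rewrite mul1r mulrBl mul1r; lra.
Qed.

(** An injective reindexing selects distinct terms of a nonnegative series. This serves to compare a
    sequence with its rearrangement and to bound column sums. *)
Lemma sum_reindex_le (R : realType) (F : nat -> R) (f : nat -> nat)
    (P : pred nat) (S : R) (N : nat) :
  (forall i, 0 <= F i) ->
  (forall i j, P i -> P j -> f i = f j -> i = j) ->
  (forall M, \sum_(i < M) F i <= S) ->
  \sum_(i < N | P i) F (f i) <= S.
Proof.
move=> F0 finj FS; pose M := (\max_(i < N) (f i).+1)%N.
have fM n : (n < N)%N -> (f n < M)%N.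
  by move=> nN; exact: (@leq_bigmax _ (fun i : 'I_N => (f i).+1) (Ordinal nN)).
apply: le_trans (FS M).
rewrite -(big_mkord P (fun i => F (f i))) -(big_mkord xpredT F).
rewrite -big_filter -(big_map f xpredT F).
set s := [seq f i | i <- _].
have us : uniq s.
  rewrite map_inj_in_uniq ?filter_uniq ?iota_uniq// => i j.
  by rewrite !mem_filter => /andP[Pi _] /andP[Pj _]; exact: finj.
have ss : {subset s <= index_iota 0 M}.
  move=> j /mapP[n]; rewrite mem_filter !mem_index_iota/= => /andP[Pn nN] ->.
  exact: fM.
rewrite [leRHS](bigID (mem s) xpredT)/= -[leLHS]addr0 lerD ?sumr_ge0//.
rewrite -[leRHS]big_filter le_eqVlt; apply/orP; left; apply/eqP/perm_big.
apply: uniq_perm => //; first by rewrite filter_uniq ?iota_uniq.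
move=> i; rewrite mem_filter; case: (boolP (i \in s)) => //= /ss.
by move=> ->.
Qed.

Lemma sum_mono_nat (R : realType) (F : nat -> R) (N M : nat) :
  (forall i, 0 <= F i) -> (N <= M)%N -> \sum_(i < N) F i <= \sum_(i < M) F i.
Proof.
move=> F0 NM; rewrite -(subnKC NM) big_split_ord/= lerDl.
by rewrite sumr_ge0.
Qed.

Lemma nneseries_leP (R : realType) (f : nat -> R) (S : R) :
  (forall k, 0 <= f k) ->
  (\sum_(0 <= k <oo) (f k)%:E <= S%:E)%E <->
  (forall K, \sum_(k < K) f k <= S).
Proof.
move=> f0; split=> H.
  move=> K; rewrite -lee_fin (le_trans _ H)// -sumEFin.
  by rewrite -(big_mkord xpredT (fun k => (f k)%:E)) nneseries_lim_ge// => i; rewrite lee_fin.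
apply: lime_le; first by apply: is_cvg_nneseries => n _ _; rewrite lee_fin.
by apply: nearW => K; rewrite big_mkord sumEFin lee_fin.
Qed.

(* The two applications of Jensen's inequality: columns of [m] for the
   exponent [s], rows of [m] for the exponent [q / s]. *)
Lemma substochastic_powR_le (R : realType) (m : nat -> nat -> R)
    (a b y : nat -> R) (s q : R) (N K : nat) :
  1 <= s -> s <= q ->
  (forall n k, 0 <= m n k) -> (forall n, 0 <= a n) -> (forall k, 0 <= b k) ->
  (forall n, 0 <= y n) ->
  (forall n K, \sum_(k < K) m n k <= 1) ->
  (forall k N, \sum_(n < N) m n k <= 1) ->
  (forall n K, \sum_(k < K) m n k * b k `^ q <= a n `^ q) ->
  \sum_(k < K) (\sum_(n < N) m n k * (b k * (y n / a n))) `^ s <=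
  \sum_(n < N) y n `^ s.
Proof.
move=> s1 sq m0 a0 b0 y0 mrow mcol mb.
have s0 : 0 < s by lra.
have q0 : 0 < q by lra.
apply: (@le_trans _ _ (\sum_(k < K) \sum_(n < N)
    m n k * (b k * (y n / a n)) `^ s)).
  apply: ler_sum => k _.
  apply: (@powR_jensen R s N (fun n => m n k) (fun n => b k * (y n / a n))) => // n.
  by rewrite mulr_ge0// divr_ge0.
rewrite exchange_big/=; apply: ler_sum => n _.
under eq_bigr do rewrite powRM ?divr_ge0// mulrA.
rewrite -mulr_suml.
have H : \sum_(k < K) m n k * b k `^ s <= a n `^ s.
  have h0 : 0 <= \sum_(k < K) m n k * b k `^ s.
    by apply: sumr_ge0 => k _; rewrite mulr_ge0 ?powR_ge0.
  (* Since q/s >= 1, Jensen's inequality along the row turns b^s into b^q. *)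
  have : (\sum_(k < K) m n k * b k `^ s) `^ (q / s) <= a n `^ q.
    apply: le_trans (mb n K).
    apply: le_trans (@powR_jensen R (q / s) K (m n) (fun k => b k `^ s) _ _ _ _) _ => //.
    - by rewrite ler_pdivlMr// mul1r.
    - by move=> i; rewrite powR_ge0.
    by apply: ler_sum => k _; rewrite -powRrM mulrCA divff ?mulr1// gt_eqF.
  move=> /(@ge0_ler_powR R (s / q) (divr_ge0 (ltW s0) (ltW q0)) _ _).
  rewrite !nnegrE !powR_ge0 => /(_ isT isT); rewrite -!powRrM.
  have -> : q / s * (s / q) = 1 by field; rewrite !gt_eqF.
  have -> : q * (s / q) = s by field; rewrite !gt_eqF.
  by rewrite powRr1.
apply: (@le_trans _ _ (a n `^ s * (y n / a n) `^ s)).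
  by rewrite ler_wpM2r ?powR_ge0.
rewrite -powRM ?divr_ge0//.
have [->|an0] := eqVneq (a n) 0; last by rewrite mulrC divfK.
by rewrite mul0r powR0 ?powR_ge0// gt_eqF.
Qed.

(* Stands in for the continuity of [powR]: the tangent line at [x k] bounds
   [t k `^ s] from below with an error linear in [e]. *)
Lemma powR_sum_lsc (R : realType) (s S : R) (K : nat) (x : nat -> R) :
  1 <= s -> (forall k, 0 <= x k) ->
  (forall e, 0 < e -> exists t : nat -> R, [/\ forall k, 0 <= t k,
     forall k, (k < K)%N -> x k - e <= t k & \sum_(k < K) t k `^ s <= S]) ->
  \sum_(k < K) x k `^ s <= S.
Proof.
move=> s1 x0 xt; set D := \sum_(k < K) s * x k `^ (s - 1).
have D0 : 0 <= D by apply: sumr_ge0 => k _; rewrite mulr_ge0 ?powR_ge0//; lra.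
apply/ler_addgt0Pr => e e0.
(* The total error will be D e/(D+1) <= e; the added 1 covers D = 0. *)
have e1 : 0 < e / (D + 1) by rewrite divr_gt0//; lra.
have [t [t0 xkt tS]] := xt _ e1.
apply: (@le_trans _ _ (\sum_(k < K) (t k `^ s + s * x k `^ (s - 1) * (e / (D + 1))))).
  apply: ler_sum => k _.
  have := powR_tangent s1 (x0 k) (t0 k).
  have : s * x k `^ (s - 1) * (x k - e / (D + 1)) <= s * x k `^ (s - 1) * t k.
    by rewrite ler_wpM2l ?mulr_ge0 ?powR_ge0 ?xkt//; lra.
  have -> : s * x k `^ (s - 1) * (x k - e / (D + 1)) =
      s * x k `^ s - s * x k `^ (s - 1) * (e / (D + 1)).
    by rewrite mulrBr -(@mulr_powRB1 _ (x k) s)//; [ring|lra].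
  by lra.
rewrite big_split/= -mulr_suml -/D lerD//.
rewrite mulrA ler_pdivrMr; last by lra.
by nra.
Qed.

(** * Consequences of bounded partial sums *)

Lemma nincr_sum_small (R : realType) (f : nat -> R) (S l : R) :
  (forall N, \sum_(n < N) f n <= S) -> 0 < l -> exists n, f n < l.
Proof.
move=> fS l0; apply: contrapT => /forallNP fl.
have /archi_boundP : 0 <= Num.max 0 (S / l) by rewrite le_max lexx.
set N := Num.bound _ => SN.
have : \sum_(n < N) l <= \sum_(n < N) f n.
  by apply: ler_sum => n _; rewrite leNgt; apply/negP; exact: fl.
rewrite sumr_const card_ord => /le_trans/(_ (fS N)).
have : S / l < N%:R by apply: le_lt_trans SN; rewrite le_max lexx orbT.
by rewrite ltr_pdivrMr// mulr_natl => /lt_le_trans h /h; rewrite ltxx.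
Qed.

Lemma sum_tail_small (R : realType) (f : nat -> R) (S l : R) :
  (forall n, 0 <= f n) -> (forall N, \sum_(n < N) f n <= S) -> 0 < l ->
  exists N, forall n, (N <= n)%N -> f n < l.
Proof.
move=> f0 fS l0.
have cf : cvgn (series f).
  apply: nondecreasing_is_cvgn; first exact: nondecreasing_series.
  by exists S => _ [n _ <-]; rewrite /series/= big_mkord.
have /cvgrPdist_lt/(_ _ l0)[N _ hN] := cvg_series_cvg_0 cf.
by exists N => n /hN; rewrite /= sub0r normrN ger0_norm.
Qed.

Lemma abs_summable (R : realType) (f : nat -> R) (S : R) :
  (forall N, \sum_(n < N) `|f n| <= S) ->
  exists l, forall e, 0 < e -> exists N0, forall N, (N0 <= N)%N ->
    `|\sum_(n < N) f n - l| < e.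
Proof.
move=> fS.
have cf : cvgn [normed series f].
  apply: nondecreasing_is_cvgn; first by apply: nondecreasing_series => n _ _; rewrite normr_ge0.
  by exists S => _ [n _ <-]; rewrite /= /series/= big_mkord.
have := normed_cvg cf => /cvg_ex[l fl]; exists l => e e0.
have /cvgrPdist_lt/(_ _ e0)[N _ hN] := fl.
by exists N => n /hN; rewrite /= distrC /series/= big_mkord.
Qed.

(** * Enumeration of a nonnegative null sequence in nonincreasing order *)

Section rearrangement_enumeration.
Local Open Scope classical_set_scope.
Variables (R : realType) (a : nat -> R).
Hypothesis a0 : forall k, 0 <= a k.
Hypothesis a_small : forall l, 0 < l -> exists N, forall k, (N <= k)%N -> a k < l.

(** For [a] the moduli of a scalar sequence this is convertible to [rearrangement]. *)
Let rearr n := inf [set l : R | 0 <= l /\ ([set k | l < a k] #<= `I_n)%card].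

Lemma card_le_count (P : pred nat) (M n : nat) :
  (forall k, P k -> (k < M)%N) ->
  ([set k | P k] #<= `I_n)%card = (count P (iota 0 M) <= n)%N.
Proof.
move=> PM; set s := [seq k <- iota 0 M | P k].
have us : uniq s by rewrite filter_uniq ?iota_uniq.
have -> : [set k | P k] = [set` [fset k in s]%fset].
  apply/seteqP; split => k /=; rewrite !inE mem_filter mem_iota add0n.
    by move=> Pk; rewrite Pk PM.
  by case/andP.
have /card_eq_fsetP/card_le_eql -> : #|` [fset k in s]%fset| = count P (iota 0 M).
  by rewrite -size_filter card_fseq undup_id.
exact: card_le_II.
Qed.

(* [j] precedes [k] in the rearrangement, ties being broken by the index. *)
Let better k j := (a k < a j) || ((a j == a k) && (j < k)%N).

Let better_gt k j : better k j -> a k <= a j.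
Proof. by case/orP => [/ltW//|/andP[/eqP-> _]]. Qed.

Let bound : forall l, {N | 0 < l -> forall k, (N <= k)%N -> a k < l}.
Proof.
move=> l; apply: cid; have [l0|_] := ltP 0 l; last by exists 0%N.
by have [N hN] := a_small l0; exists N.
Qed.

Let ltn_bound l k : 0 < l -> l <= a k -> (k < sval (bound l))%N.
Proof.
move=> l0 lk; rewrite ltnNge; apply/negP => /(svalP (bound l) l0).
by rewrite ltNge lk.
Qed.

Let ltn_bound_better k j : 0 < a k -> better k j -> (j < sval (bound (a k)))%N.
Proof. by move=> ak /better_gt; exact: ltn_bound. Qed.

(** The position of [k] in the rearrangement, counted from 0. It is meaningful only for [a k > 0],
    when all predecessors of [k] lie below the bound. *)
Let rank k := count (better k) (iota 0 (sval (bound (a k)))).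

Let card_le_rank k n : 0 < a k ->
  ([set j | better k j] #<= `I_n)%card = (rank k <= n)%N.
Proof. by move=> ak; apply: card_le_count => j; exact: ltn_bound_better. Qed.

(** Allows ranks of different indices to be counted over one common segment. *)
Let rankE k M : 0 < a k -> (forall j, better k j -> (j < M)%N) ->
  rank k = count (better k) (iota 0 M).
Proof.
move=> ak kM; apply/eqP; rewrite eqn_leq -card_le_rank// (@card_le_count _ M)// leqnn/=.
by rewrite -(@card_le_count _ M)// card_le_rank.
Qed.

Let better_lt_rank k j : 0 < a k -> better k j -> (rank j < rank k)%N.
Proof.
move=> ak kj; have akj := better_gt kj; have aj : 0 < a j by exact: lt_le_trans akj.
have sub i : better j i -> better k i.
  rewrite /better; move: kj; rewrite /better.
  move=> /orP[kj|/andP[/eqP <- jk]] /orP[ji|/andP[/eqP ji ij]].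
  - by rewrite (lt_trans kj).
  - by rewrite ji kj.
  - by rewrite ji.
  - by rewrite ji eqxx (ltn_trans ij) ?orbT.
have jj : better j j = false by rewrite /better ltxx ltnn andbF.
set M := sval (bound (a k)).
have hk i : better k i -> (i < M)%N by exact: ltn_bound_better.
rewrite (rankE aj (fun i ji => hk i (sub i ji))) (rankE ak hk).
have jM : j \in iota 0 M by rewrite mem_iota add0n hk.
rewrite !(permP (perm_to_rem jM))/= jj kj add0n add1n ltnS.
exact: sub_count.
Qed.

Let better_total k j : k != j -> better k j || better j k.
Proof.
by rewrite /better; case: (ltgtP (a k) (a j)) => //= _; rewrite orbC neq_ltn.
Qed.

Let rank_inj k j : 0 < a k -> 0 < a j -> rank k = rank j -> k = j.
Proof.
move=> ak aj kj; apply/eqP; apply: contraT => /better_total/orP[] /better_lt_rank.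
  by move=> /(_ ak); rewrite kj ltnn.
by move=> /(_ aj); rewrite kj ltnn.
Qed.

Let levelP (l : R) (n : nat) : 0 < l -> ([set k | l < a k] #<= `I_n)%card =
  (count (fun k => (l < a k)%R) (iota 0 (sval (bound l))) <= n)%N.
Proof. by move=> l0; apply: card_le_count => k /ltW; exact: ltn_bound. Qed.

(** Indices strictly above the level [a k] precede [k], so there are at most [rank k] of them. Any
    lower level is exceeded by these predecessors and by [k] itself, which is one too many. *)
Let rearr_rank k : 0 < a k -> rearr (rank k) = a k.
Proof.
move=> ak; apply/eqP; rewrite eq_le; apply/andP; split.
  apply: ge_inf; first by exists 0 => x [].
  split; first exact: ltW.
  have := leqnn (rank k); rewrite -card_le_rank//; apply: card_le_trans.
  by apply: subset_card_le => j /= kj; rewrite /better kj.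
apply: lb_le_inf.
  exists (a k); split; first exact: ltW.
  have := leqnn (rank k); rewrite -card_le_rank//; apply: card_le_trans.
  by apply: subset_card_le => j /= kj; rewrite /better kj.
move=> l [l0 hl]; rewrite leNgt; apply/negP => lk.
have : ([set j | better k j || (j == k)] #<= `I_(rank k))%card.
  apply: card_le_trans hl; apply: subset_card_le => j /= /orP[/better_gt|/eqP->//].
  exact: lt_le_trans.
have hk j : better k j || (j == k) -> (j < sval (bound (a k)))%N.
  by move=> /orP[|/eqP->]; [exact: ltn_bound_better|exact: ltn_bound].
rewrite (card_le_count _ hk) leqNgt => /negP; apply.
rewrite /rank; have kM : k \in iota 0 (sval (bound (a k))).
  by rewrite mem_iota add0n ltn_bound.
rewrite !(permP (perm_to_rem kM))/= eqxx orbT.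
rewrite /better ltxx ltnn andbF/= add0n add1n ltnS.
by apply: sub_count => j /= ->.
Qed.

(** More than [n] indices exceed half of [rearr n]. They are closed under predecessors, so their
    distinct ranks fill an initial segment, which contains [n]. *)
Let rank_surj n : 0 < rearr n -> exists2 k, 0 < a k & rank k = n.
Proof.
move=> rn; set l := rearr n / 2.
have l0 : 0 < l by rewrite divr_gt0.
have : ~ ([set k | l < a k] #<= `I_n)%card.
  move=> hl; have : rearr n <= l.
    by apply: ge_inf; [exists 0 => x []|split => //; exact: ltW].
  by rewrite /l; lra.
rewrite levelP// => /negP; rewrite -ltnNge.
set F := [seq k <- iota 0 (sval (bound l)) | l < a k].
rewrite -size_filter -/F => nF.
have Fa k : k \in F -> l < a k by rewrite mem_filter => /andP[].
have uF : uniq [seq rank k | k <- F].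
  rewrite map_inj_in_uniq ?filter_uniq ?iota_uniq// => k j /Fa lk /Fa lj.
  by apply: rank_inj; exact: lt_trans l0 _.
have sF : {subset [seq rank k | k <- F] <= iota 0 (size F)}.
  move=> r /mapP[k kF ->]; have lk := Fa _ kF; rewrite mem_iota add0n/=.
  have ak := lt_trans l0 lk.
  have hk j : better k j -> (j < sval (bound l))%N.
    by move=> /better_gt kj; apply: ltn_bound => //; rewrite ltW// (lt_le_trans lk).
  rewrite (rankE ak hk) size_filter.
  have kM : k \in iota 0 (sval (bound l)) by rewrite mem_iota add0n ltn_bound// ltW.
  rewrite !(permP (perm_to_rem kM))/= lk /better ltxx ltnn andbF/= add0n add1n ltnS.
  by apply: sub_count => j /= /better_gt; exact: lt_le_trans.
have := (uniq_min_size uF sF _).2 n; rewrite size_iota size_map => /(_ (leqnn _)).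
rewrite mem_iota add0n nF => /mapP[k kF nk].
by exists k => //; apply: lt_trans (Fa _ kF).
Qed.

(** Needed to bound the infimum from below. The witness exceeds the first N terms through their sum
    and the later ones through the summand 1. *)
Let bounded_nonempty n :
  [set l : R | 0 <= l /\ ([set k | l < a k] #<= `I_n)%card] !=set0.
Proof.
have [N hN] := a_small ltr01.
have S0 : 0 <= \sum_(i < N) a i by rewrite sumr_ge0.
exists (1 + \sum_(i < N) a i); split; first by rewrite addr_ge0.
rewrite [X in (X #<= _)%card](_ : _ = set0) ?card_le_emptyl//.
apply/seteqP; split => k //=; rewrite ltNge => /negP; apply.
have [kN|/hN] := ltnP k N; last by lra.
rewrite (bigD1 (Ordinal kN))//= addrCA lerDl addr_ge0// sumr_ge0//.
Qed.

Lemma rearrangement_ge0 n : 0 <= rearr n.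
Proof. by apply: lb_le_inf => // l []. Qed.

Lemma rearrangement_nincr n : rearr n.+1 <= rearr n.
Proof.
apply: lb_le_inf => // l [l0 hl]; apply: ge_inf; first by exists 0 => x [].
by split => //; apply: card_le_trans hl _; rewrite card_le_II.
Qed.

(** [rk] and [tau] are inverse bijections between the positive terms of the sequence and those of
    its rearrangement. Zeros are left out: infinitely many positive terms push them out of the
    rearrangement. *)
Lemma rearrangement_enumeration : exists (rk tau : nat -> nat),
  [/\ forall k, 0 < a k -> rearr (rk k) = a k /\ tau (rk k) = k &
      forall n, 0 < rearr n -> a (tau n) = rearr n /\ rk (tau n) = n].
Proof.
have tau n : {k | 0 < rearr n -> 0 < a k /\ rank k = n}.
  apply: cid; have [rn|_] := ltP 0 (rearr n); last by exists 0%N.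
  by have [k ak kn] := rank_surj rn; exists k.
exists rank, (fun n => sval (tau n)); split => [k ak|n rn].
  have rk := rearr_rank ak; split => //.
  case: (tau _) => j /=; rewrite rk => /(_ ak)[aj jk].
  exact: rank_inj.
have [ak kn] := svalP (tau n) rn; split => //.
by rewrite -[in RHS]kn rearr_rank.
Qed.

End rearrangement_enumeration.

(** * The greedy construction of the matrix *)

(** Entries k and k+1 are replaced by the single entry [c] and the rest is shifted. The type is
    arbitrary because both values and rows are merged. *)
Definition merge2 (V : Type) (k : nat) (c : V) (f : nat -> V) (i : nat) : V :=
  if (i < k)%N then f i else if i == k then c else f i.+1.

Lemma sum_merge2_lt (V : nmodType) (k : nat) (c : V) (f : nat -> V) (N : nat) :
  (N <= k)%N -> \sum_(i < N) merge2 k c f i = \sum_(i < N) f i.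
Proof.
by move=> Nk; apply: eq_bigr => i _; rewrite /merge2 (leq_trans (ltn_ord i)).
Qed.

Lemma sum_merge2 (V : nmodType) (k : nat) (r c : V) (f : nat -> V) (N : nat) :
  r + c = f k + f k.+1 -> (k < N)%N ->
  r + \sum_(i < N) merge2 k c f i = \sum_(i < N.+1) f i.
Proof.
move=> rc; elim: N => // N IH; rewrite ltnS leq_eqVlt => /predU1P[kN|kN].
  rewrite -kN big_ord_recr/= sum_merge2_lt// /merge2 ltnn eqxx.
  by rewrite addrCA rc addrA !big_ord_recr.
rewrite big_ord_recr addrA IH//= [RHS]big_ord_recr/= /merge2.
by rewrite ltnNge (ltnW kN)/= gtn_eqF.
Qed.

Section majorization.
Variables (R : realType) (b : nat -> R).

(* [beta] is the sum of the series [sum_j w j * b j], whose partial sums are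
   eventually constant for all rows that the algorithm produces. *)
Definition pairs_to (w : nat -> R) (beta : R) :=
  [/\ forall j, 0 <= w j, forall K, \sum_(j < K) w j <= 1 &
      exists K0, forall K, (K0 <= K)%N -> \sum_(j < K) w j * b j = beta].

Lemma pairs_to_convex t w1 w2 c1 c2 : 0 <= t <= 1 ->
  pairs_to w1 c1 -> pairs_to w2 c2 ->
  pairs_to (fun j => t * w1 j + (1 - t) * w2 j) (t * c1 + (1 - t) * c2).
Proof.
move=> /andP[t0 t1] [p1 s1 [K1 h1]] [p2 s2 [K2 h2]]; split.
- by move=> j; rewrite addr_ge0// mulr_ge0// subr_ge0.
- move=> K; rewrite big_split/= -!mulr_sumr.
  rewrite [leRHS](_ : 1 = t * 1 + (1 - t) * 1); last by ring.
  apply: lerD; apply: ler_wpM2l; rewrite ?subr_ge0//; [exact: s1|exact: s2].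
exists (maxn K1 K2) => K; rewrite geq_max => /andP[H1 H2].
under eq_bigr do rewrite mulrDl -!mulrA.
by rewrite big_split/= -!mulr_sumr h1// h2.
Qed.

(* The state of the greedy algorithm: the rows [w] still available, with
   values [beta], when [a] is the part of the sequence to be represented. *)
Record dominates (a beta : nat -> R) (w : nat -> nat -> R) : Prop := {
  dom_pairs : forall i, pairs_to (w i) (beta i);
  dom_nincr : forall i, beta i.+1 <= beta i;
  dom_ge0 : forall i, 0 <= beta i;
  dom_small : forall l, 0 < l -> exists i, beta i < l;
  dom_sum : forall N, \sum_(i < N) a i <= \sum_(i < N) beta i }.

Lemma nincr_le (f : nat -> R) i j :
  (forall i, f i.+1 <= f i) -> (i <= j)%N -> f j <= f i.
Proof.
move=> fi; elim: j => [|j IH]; first by rewrite leqn0 => /eqP->.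
by rewrite leq_eqVlt => /predU1P[->//|ij]; exact: le_trans (IH _).
Qed.

(** The last conclusion says that the emitted row and the new rows together use no more of any
    column than the old rows did; this keeps column sums bounded. *)
Lemma dominates_step a beta w :
  (forall i, a i.+1 <= a i) -> (forall i, 0 <= a i) ->
  dominates a beta w ->
  exists r beta' w', [/\ pairs_to r (a 0%N),
    dominates (fun i => a i.+1) beta' w' &
    forall N, exists N', forall j,
      r j + \sum_(i < N) w' i j <= \sum_(i < N') w i j].
Proof.
move=> ai a0 [dp dn d0 ds dm].
(* If [a 0] vanishes, so does all of [a], and a zero row is emitted; a pivot [k] need not exist, as
   [beta] may stay positive. *)
have [a00|a00] := eqVneq (a 0%N) 0.
  exists (fun=> 0), beta, w; split.
  - split => //; first by move=> K; rewrite big1.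
    by exists 0%N => K _; rewrite a00 big1// => j _; rewrite mul0r.
  - split => // N; apply: le_trans (sumr_ge0 _ _) => //.
    rewrite big1// => i _; apply/eqP; rewrite eq_le a0 andbT -a00.
    exact: nincr_le.
  - by move=> N; exists N => j; rewrite add0r.
have a0p : 0 < a 0%N by rewrite lt_neqAle eq_sym a00 a0.
(* Descend from an index where [beta] is below [a 0]; domination for one term stops the descent
   before index 0. *)
have [k [hk hk1]] : exists k, a 0%N <= beta k /\ beta k.+1 < a 0%N.
  have [m] := ds _ a0p.
  elim: m => [|m IH] hi.
    by have := dm 1%N; rewrite !big_ord1 leNgt hi.
  by have [h|/IH//] := leP (a 0%N) (beta m); exists m.
have bk : 0 < beta k - beta k.+1 by rewrite subr_gt0 (lt_le_trans hk1).
set t := (a 0%N - beta k.+1) / (beta k - beta k.+1).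
have t01 : 0 <= t <= 1.
  by apply/andP; split; [apply: divr_ge0; lra|rewrite ler_pdivrMr//; lra].
have t01' : 0 <= 1 - t <= 1 by case/andP: t01 => *; apply/andP; split; lra.
have a0E : a 0%N = t * beta k + (1 - t) * beta k.+1.
  by rewrite /t; field; rewrite gt_eqF.
set c := (1 - t) * beta k + t * beta k.+1.
set r := fun j => t * w k j + (1 - t) * w k.+1 j.
set cw := fun j => (1 - t) * w k j + t * w k.+1 j.
have tt : 1 - (1 - t) = t by ring.
have c1 : beta k.+1 <= c.
  have : 0 <= (1 - t) * (beta k - beta k.+1) by case/andP: t01' => *; rewrite mulr_ge0// ltW.
  by rewrite /c; lra.
have c2 : c <= beta k.
  have : 0 <= t * (beta k - beta k.+1) by case/andP: t01 => *; rewrite mulr_ge0// ltW.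
  by rewrite /c; lra.
exists r, (merge2 k c beta), (merge2 k cw w); split.
- by rewrite a0E; exact: pairs_to_convex.
- split.
  + move=> i; rewrite /merge2; case: ifP => // _; case: eqP => // _.
    by have := pairs_to_convex t01' (dp k) (dp k.+1); rewrite tt.
  + move=> i; rewrite /merge2; case: (ltngtP i.+1 k) => [ik|ik|ik].
    * exact: dn.
    * by case: eqP => [->|_]; [exact: le_trans c1|exact: dn].
    * by apply: le_trans c2 _; rewrite -ik; exact: dn.
  + move=> i; rewrite /merge2; do 2 case: ifP => // _.
    exact: le_trans (d0 _) c1.
  + move=> l /ds[m ml]; exists (maxn m k.+1); rewrite /merge2.
    rewrite ltnNge (leq_trans (leqnSn k) (leq_maxr _ _))/= gtn_eqF ?leq_maxr//.
    apply: le_lt_trans ml; apply: nincr_le => //.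
    by rewrite (leq_trans (leq_maxl m k.+1)).
  (* Up to [k] each new entry is an old one, at least [beta k >= a 0]. Beyond [k], both partial sums
     of length N+1 have lost exactly [a 0]. *)
  + move=> N; have [Nk|kN] := leqP N k.
      rewrite sum_merge2_lt//; apply: ler_sum => i _.
      apply: (le_trans (nincr_le (j := i.+1) ai (leq0n _))); apply: (le_trans hk).
      by apply: nincr_le => //; rewrite (leq_trans _ Nk)// ltnW.
    rewrite -(lerD2l (a 0%N)) (sum_merge2 _ kN).
      by have := dm N.+1; rewrite big_ord_recl.
    by rewrite a0E /c; ring.
(* Long enough to reach past the merged pair, where the column sums balance exactly. *)
- move=> N; exists (N + k).+2 => j.
  have wj i : 0 <= w i j by case: (dp i).
  have <- : r j + \sum_(i < (N + k).+1) merge2 k (cw j) (w^~ j) i =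
      \sum_(i < (N + k).+2) w i j.
    by apply: sum_merge2; [rewrite /r /cw; ring | rewrite ltnS leq_addl].
  rewrite lerD2l.
  rewrite (eq_bigr (fun i : 'I_N => merge2 k (cw j) (w^~ j) i)); last first.
    by move=> i _; rewrite /merge2; do 2 case: ifP => //.
  apply: (sum_mono_nat (F := merge2 k (cw j) (w^~ j))); last first.
    by rewrite -addnS leq_addr.
  move=> i; rewrite /merge2; do 2 case: ifP => // _.
  by case/andP: t01' => *; case/andP: t01 => *; rewrite addr_ge0// mulr_ge0.
Qed.

Lemma dominates_matrix a beta w :
  (forall i, a i.+1 <= a i) -> (forall i, 0 <= a i) ->
  dominates a beta w ->
  exists r : nat -> nat -> R, (forall n, pairs_to (r n) (a n)) /\
    forall N, exists N', forall j, \sum_(n < N) r n j <= \sum_(i < N') w i j.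
Proof.
move=> ai a0 dom0.
pose state := ((nat -> R) * (nat -> nat -> R))%type.
(* Domination is a premise inside the choice, so that the step is a total function and can be
   iterated; other states get a default value. *)
have step : forall ns : nat * state, {rs : (nat -> R) * state |
    dominates (fun i => a (ns.1 + i)%N) ns.2.1 ns.2.2 ->
    [/\ pairs_to rs.1 (a ns.1),
      dominates (fun i => a (ns.1.+1 + i)%N) rs.2.1 rs.2.2 &
      forall N, exists N', forall j,
        rs.1 j + \sum_(i < N) rs.2.2 i j <= \sum_(i < N') ns.2.2 i j]}.
  move=> [n [be wn]]; apply: cid => /=.
  have [d|d] := pselect (dominates (fun i => a (n + i)%N) be wn); last first.
    by exists ((fun=> 0), (be, wn)) => /d.
  have [||r [be' [w' [h1 h2 h3]]]] := dominates_step _ _ d.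
  - by move=> i; rewrite addnS.
  - by [].
  exists (r, (be', w')) => _; split => //=; first by rewrite -[n]addn0.
  by move: h2; under eq_fun do rewrite addnS -addSn.
pose next n s := (sval (step (n, s))).2.
pose S := fix S n : state := if n is n'.+1 then next n' (S n') else (beta, w).
have domS n : dominates (fun i => a (n + i)%N) (S n).1 (S n).2.
  by elim: n => // n IH; have [] := svalP (step (n, S n)) IH.
pose row n := (sval (step (n, S n))).1.
exists row; split; first by move=> n; have [] := svalP (step (n, S n)) (domS n).
(* The induction must also account for the rows still available; M = 0 gives the claim. *)
suff H : forall N M, exists N', forall j,
    \sum_(n < N) row n j + \sum_(i < M) (S N).2 i j <= \sum_(i < N') w i j.
  move=> N; have [N' hN'] := H N 0%N; exists N' => j.
  by apply: le_trans (hN' j); rewrite big_ord0 addr0.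
elim=> [|N IH] M; first by exists M => j; rewrite big_ord0 add0r.
have [_ _ /(_ M)[M' hM']] := svalP (step (N, S N)) (domS N).
have [N' hN'] := IH M'; exists N' => j; apply: le_trans (hN' j).
by rewrite big_ord_recr/= -addrA lerD2l; exact: hM'.
Qed.

End majorization.

(** * From the rearrangements back to the sequences *)

Section majorization_matrix.
Local Open Scope classical_set_scope.
Variables (R : realType) (q : R) (a b : nat -> R) (A B : R).
Hypothesis q0 : 0 < q.
Hypothesis a0 : forall k, 0 <= a k.
Hypothesis b0 : forall k, 0 <= b k.
(** With [a_sum_near] this makes [A] the exact total of a^q, whereas [B] is just some bound. *)
Hypothesis a_sum : forall N : nat, \sum_(n < N) a n `^ q <= A.
Hypothesis a_sum_near : forall e, 0 < e ->
  exists N : nat, A - e < \sum_(n < N) a n `^ q.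
Hypothesis b_bounded : forall N : nat, \sum_(n < N) b n `^ q <= B.

Let rearr (c : nat -> R) n :=
  inf [set l : R | 0 <= l /\ ([set k | l < c k] #<= `I_n)%card].

Hypothesis partial_le : forall N : nat,
  \sum_(n < N) rearr a n `^ q <= \sum_(n < N) rearr b n `^ q.
Hypothesis total_ge : forall S,
  (forall N : nat, \sum_(n < N) rearr a n `^ q <= S) ->
  forall N : nat, \sum_(n < N) rearr b n `^ q <= S.

Let small (c : nat -> R) (S : R) : (forall k, 0 <= c k) ->
  (forall N : nat, \sum_(n < N) c n `^ q <= S) ->
  forall l, 0 < l -> exists N, forall k, (N <= k)%N -> c k < l.
Proof.
move=> c0 cS l l0.
have [N hN] := sum_tail_small (fun n => powR_ge0 (c n) q) cS (powR_gt0 q l0).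
exists N => k /hN; apply: contraTT; rewrite -!leNgt => lk.
by rewrite ge0_ler_powR ?nnegrE// ltW.
Qed.

Let enum (c : nat -> R) :
  (forall l, 0 < l -> exists N, forall k, (N <= k)%N -> c k < l) ->
  exists rk tau : nat -> nat,
  [/\ forall k, 0 < c k -> rearr c (rk k) = c k /\ tau (rk k) = k &
      forall n, 0 < rearr c n -> c (tau n) = rearr c n /\ rk (tau n) = n].
Proof. exact: rearrangement_enumeration. Qed.

Let rearr_a_sum (N : nat) : \sum_(n < N) rearr a n `^ q <= A.
Proof.
have [rk [tau [h1 h2]]] := enum (small a0 a_sum).
rewrite (bigID (fun n : 'I_N => 0 < rearr a n))/= [X in _ + X]big1 ?addr0.
  rewrite (eq_bigr (fun n : 'I_N => a (tau n) `^ q)) => [|n /h2[->]//].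
  apply: (@sum_reindex_le R (fun n => a n `^ q) tau (fun n => 0 < rearr a n)) => // [n|i j hi hj ij].
    exact: powR_ge0.
  by have [_ <-] := h2 _ hi; have [_ <-] := h2 _ hj; rewrite ij.
move=> n; rewrite -leNgt => r0.
have -> : rearr a n = 0.
  by apply/eqP; rewrite eq_le r0 rearrangement_ge0//; exact: small a_sum.
by rewrite powR0// gt_eqF.
Qed.

Let rearr_b_sum (N : nat) : \sum_(n < N) rearr b n `^ q <= A.
Proof. by move: N; apply: total_ge; exact: rearr_a_sum. Qed.

(** The equality of total masses enters here: b^q has at most the mass of a^q, which later forces
    full columns. *)
Let b_sum (N : nat) : \sum_(n < N) b n `^ q <= A.
Proof.
have [rk [tau [h1 h2]]] := enum (small b0 b_bounded).
rewrite (bigID (fun n : 'I_N => 0 < b n))/= [X in _ + X]big1 ?addr0.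
  rewrite (eq_bigr (fun n : 'I_N => rearr b (rk n) `^ q)) => [|n /h1[->]//].
  apply: (@sum_reindex_le R (fun n => rearr b n `^ q) rk (fun n => 0 < b n)) => // [n|i j hi hj ij].
    exact: powR_ge0.
  by have [_ <-] := h1 _ hi; have [_ <-] := h1 _ hj; rewrite ij.
move=> n; rewrite -leNgt => r0.
have -> : b n = 0 by apply/eqP; rewrite eq_le r0 b0.
by rewrite powR0// gt_eqF.
Qed.

(** The initial rows are unit vectors locating the entries of the rearrangement inside [b], or zero
    rows where it vanishes. Injectivity of [tau] bounds the columns. *)
Let dominates_rearr : exists w,
  dominates (fun j => b j `^ q) (fun n => rearr a n `^ q)
    (fun n => rearr b n `^ q) w /\
  forall N j, \sum_(i < N) w i j <= 1.
Proof.
have [rk [tau [h1 h2]]] := enum (small b0 b_bounded).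
have r0 n : 0 <= rearr b n by apply: rearrangement_ge0 => //; exact: small b_bounded.
have one (i : nat) K : \sum_(j < K) ((j : nat) == i)%:R <= 1 :> R.
  have [iK|Ki] := ltnP i K.
    rewrite (bigD1 (Ordinal iK))//= eqxx big1 ?addr0// => j.
    by rewrite -val_eqE/= => /negbTE->.
  by rewrite big1// => j _; rewrite ltn_eqF// (leq_trans (ltn_ord j)).
exists (fun i j => if 0 < rearr b i then (j == tau i)%:R else 0); split; last first.
  move=> N j; rewrite -big_mkcond/=.
  apply: (@sum_reindex_le R (fun l => (j == l)%:R) tau (fun i => 0 < rearr b i)) => // [i i' hi hi' ii'|M].
    by have [_ <-] := h2 _ hi; have [_ <-] := h2 _ hi'; rewrite ii'.
  by under eq_bigr do rewrite eq_sym; exact: one.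
split.
- move=> i /=; case: (boolP (0 < rearr b i)) => [ri|]; last first.
    rewrite -leNgt => ri; have -> : rearr b i = 0 by apply/eqP; rewrite eq_le ri r0.
    split; [by []|by move=> K; rewrite big1|].
    by exists 0%N => K _; rewrite big1 ?powR0 ?gt_eqF// => j _; rewrite mul0r.
  split; [by []|by move=> K; exact: one|].
  exists (tau i).+1 => K iK; rewrite (bigD1 (Ordinal iK))//= eqxx mul1r big1 ?addr0.
    by have [-> _] := h2 _ ri.
  by move=> j; rewrite -val_eqE/= => /negbTE->; rewrite mul0r.
- move=> i; rewrite ge0_ler_powR ?nnegrE ?r0//; first exact: ltW.
  by apply: rearrangement_nincr => //; exact: small b_bounded.
- by move=> i; exact: powR_ge0.
- by move=> l; exact: (nincr_sum_small rearr_b_sum).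
- exact: partial_le.
Qed.

(** The greedy rows represent the rearrangement of [a], so [rk] relabels them; zero terms of [a] get
    zero rows. Full columns come from a mass balance: the deficits 1 - sum_n m_(nk), weighted by
    b_k^q, add up to at most the missing tail of a^q. *)
Lemma majorization_matrix : exists m : nat -> nat -> R,
  [/\ forall n k, 0 <= m n k,
      forall n K, \sum_(k < K) m n k <= 1,
      forall k N, \sum_(n < N) m n k <= 1,
      forall n K, \sum_(k < K) m n k * b k `^ q <= a n `^ q &
      (forall n k, a n = 0 -> m n k = 0) /\
      forall k e, 0 < b k -> 0 < e -> exists N0, forall N, (N0 <= N)%N ->
        1 - e < \sum_(n < N) m n k].
Proof.
have [w [wdom wcol]] := dominates_rearr.
have a_small := small a0 a_sum.
have [r [rp rcol']] : exists r : nat -> nat -> R,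
    (forall n, pairs_to (fun j => b j `^ q) (r n) (rearr a n `^ q)) /\
    forall N, exists N', forall j, \sum_(n < N) r n j <= \sum_(i < N') w i j.
  apply: dominates_matrix wdom => i; last exact: powR_ge0.
  rewrite ge0_ler_powR ?nnegrE//; first exact: ltW.
  - exact: rearrangement_ge0.
  - exact: rearrangement_ge0.
  - exact: rearrangement_nincr.
have rcol N j : \sum_(n < N) r n j <= 1.
  by have [N' h] := rcol' N; exact: le_trans (h j) (wcol _ _).
have r0 n k : 0 <= r n k by case: (rp n).
have [rk [tau [h1 _]]] := enum a_small.
pose m n k := if 0 < a n then r (rk n) k else 0.
have m0 n k : 0 <= m n k by rewrite /m; case: ifP.
have mE n : exists K0, forall K, (K0 <= K)%N ->
    \sum_(k < K) m n k * b k `^ q = a n `^ q.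
  rewrite /m; have [an|] := ltP 0 (a n).
    by have [_ _ [K0 hK0]] := rp (rk n); exists K0 => K /hK0; have [-> _] := h1 _ an.
  move=> an; have -> : a n = 0 by apply/eqP; rewrite eq_le an a0.
  exists 0%N => K _; rewrite powR0 ?gt_eqF//.
  by rewrite big1// => k _; rewrite mul0r.
have mcol k N : \sum_(n < N) m n k <= 1.
  rewrite /m -big_mkcond/=; apply: (@sum_reindex_le R (fun i => r i k) rk (fun n => 0 < a n)) => //.
  by move=> i j hi hj ij; have [_ <-] := h1 _ hi; have [_ <-] := h1 _ hj; rewrite ij.
exists m; split => //.
- move=> n K; rewrite /m; case: (boolP (0 < a n)) => _; first by case: (rp (rk n)).
  by rewrite big1.
- move=> n K; have [K0 hK0] := mE n.
  rewrite -(hK0 (maxn K0 K)) ?leq_maxl//.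
  apply: (sum_mono_nat (F := fun k => m n k * b k `^ q)); last exact: leq_maxr.
  by move=> k; rewrite mulr_ge0 ?powR_ge0.
split=> [n k an|k e bk e0]; first by rewrite /m an ltxx.
have bq : 0 < b k `^ q by exact: powR_gt0.
have [N0 hN0] := a_sum_near (mulr_gt0 e0 bq).
exists N0 => N NN0.
(* One truncation at which the first N row sums are all exact, so that the finite double sum can be
   exchanged. *)
have [K0 hK0] : exists K0, forall n K, (n < N)%N -> (K0 <= K)%N ->
    \sum_(k < K) m n k * b k `^ q = a n `^ q.
  elim: (N) => [|M [K0 hK0]]; first by exists 0%N.
  have [K1 hK1] := mE M; exists (maxn K0 K1) => n K.
  rewrite ltnS leq_eqVlt geq_max => /predU1P[->|nM] /andP[H0 H1]; first exact: hK1.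
  exact: hK0.
set K := maxn K0 k.+1.
have H1 : \sum_(n < N) a n `^ q = \sum_(j < K) (\sum_(n < N) m n j) * b j `^ q.
  under [RHS]eq_bigr do rewrite mulr_suml.
  by rewrite exchange_big/=; apply: eq_bigr => n _; rewrite hK0// leq_maxl.
have H2 : A - e * b k `^ q < \sum_(n < N) a n `^ q.
  apply: lt_le_trans hN0 _; apply: (sum_mono_nat (F := fun n => a n `^ q)) => // n.
  exact: powR_ge0.
have kK : (k < K)%N by rewrite leq_maxr.
have H3 : (1 - \sum_(n < N) m n k) * b k `^ q <=
    \sum_(j < K) (1 - \sum_(n < N) m n j) * b j `^ q.
  rewrite (bigD1 (Ordinal kK))//= lerDl sumr_ge0// => j _.
  by apply: mulr_ge0; [rewrite subr_ge0; exact: mcol|exact: powR_ge0].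
have H4 : \sum_(j < K) (1 - \sum_(n < N) m n j) * b j `^ q <=
    A - \sum_(n < N) a n `^ q.
  under eq_bigr do rewrite mulrBl mul1r.
  by rewrite sumrB -H1 lerD2r; exact: b_sum.
have : (1 - \sum_(n < N) m n k) * b k `^ q < e * b k `^ q.
  by apply: le_lt_trans H3 _; lra.
by rewrite ltr_pM2r//; lra.
Qed.

End majorization_matrix.

(** * Real and complex scalars treated together *)

Lemma normc_summable (R : realType) (f : nat -> R[i]) (S : R) :
  (forall N, \sum_(n < N) ComplexField.Normc.normc (f n) <= S) ->
  exists l, forall e : R, 0 < e -> exists N0, forall N, (N0 <= N)%N ->
    ComplexField.Normc.normc (\sum_(n < N) f n - l) < e.
Proof.
move=> fS.
have ReS N : \sum_(n < N) `|complex.Re (f n)| <= S.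
  apply: le_trans (fS N); apply: ler_sum => n _.
  by case: (f n) => u v /=; rewrite -sqrtr_sqr ler_wsqrtr// lerDl sqr_ge0.
have ImS N : \sum_(n < N) `|complex.Im (f n)| <= S.
  apply: le_trans (fS N); apply: ler_sum => n _.
  by case: (f n) => u v /=; rewrite -sqrtr_sqr ler_wsqrtr// lerDr sqr_ge0.
have [l hl] := abs_summable (f := fun n => complex.Re (f n)) ReS.
have [m hm] := abs_summable (f := fun n => complex.Im (f n)) ImS.
exists (Complex l m) => e e0.
have e2 : 0 < e / 2 by rewrite divr_gt0.
have [N1 H1] := hl _ e2; have [N2 H2] := hm _ e2.
exists (maxn N1 N2) => N; rewrite geq_max => /andP[/H1 {}H1 /H2 {}H2].
have -> : \sum_(n < N) f n - Complex l m =
    Complex (\sum_(n < N) complex.Re (f n) - l) (\sum_(n < N) complex.Im (f n) - m).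
  rewrite (_ : \sum_(n < N) f n =
      Complex (\sum_(n < N) complex.Re (f n)) (\sum_(n < N) complex.Im (f n)))//.
  elim: (N) => [|M IH]; first by rewrite !big_ord0.
  by rewrite !big_ord_recr IH /=; case: (f _).
move: H1 H2; set u := _ - l; set v := _ - m => H1 H2 /=.
have uv0 : 0 <= `|u| + `|v| by rewrite addr_ge0.
apply: (@le_lt_trans _ _ (`|u| + `|v|)); last lra.
rewrite -[leRHS](ger0_norm uv0) -sqrtr_sqr ler_wsqrtr//.
rewrite -(real_normK (num_real u)) -(real_normK (num_real v)) sqrrD.
by rewrite lerD2r lerDl mulrn_wge0// mulr_ge0.
Qed.

Section scalars_theory.
Variables (R : realType) (fld : base_field).
Implicit Types (x y : scalars R fld) (r : R).

Definition scalar_of (r : R) : scalars R fld :=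
  match fld return scalars R fld with
  | RealScalars => r
  | ComplexScalars => (r%:C)%C
  end.

Lemma scalar_ofD r1 r2 : scalar_of (r1 + r2) = scalar_of r1 + scalar_of r2.
Proof. by rewrite /scalar_of; case: fld => //=; rewrite rmorphD. Qed.

Lemma scalar_of0 : scalar_of 0 = 0.
Proof. by rewrite /scalar_of; case: fld. Qed.

Lemma scalar_of1 : scalar_of 1 = 1.
Proof. by rewrite /scalar_of; case: fld. Qed.

Lemma scalar_ofN r : scalar_of (- r) = - scalar_of r.
Proof. by rewrite /scalar_of; case: fld => //=; rewrite rmorphN. Qed.

Lemma scalar_of_sum N (f : nat -> R) :
  scalar_of (\sum_(n < N) f n) = \sum_(n < N) scalar_of (f n).
Proof.
by apply: (big_morph scalar_of); [exact: scalar_ofD|exact: scalar_of0].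
Qed.

Lemma modulus_scalar_of r : modulus (scalar_of r) = `|r|.
Proof.
rewrite /scalar_of /modulus; case: fld => //=.
by rewrite expr0n/= addr0 sqrtr_sqr.
Qed.

Lemma modulus_ge0 x : 0 <= modulus x.
Proof. by move: x; rewrite /modulus; case: fld => //= -[? ?]; exact: sqrtr_ge0. Qed.

Lemma modulus_eq0 x : modulus x = 0 -> x = 0.
Proof.
move: x; rewrite /modulus; case: fld => x; first exact: normr0_eq0.
exact: ComplexField.Normc.eq0_normc.
Qed.

Lemma modulusM x y : modulus (x * y) = modulus x * modulus y.
Proof.
move: x y; rewrite /modulus; case: fld => x y; first exact: normrM.
exact: ComplexField.Normc.normcM.
Qed.

Lemma modulus0 : modulus (0 : scalars R fld) = 0.
Proof. by rewrite -scalar_of0 modulus_scalar_of normr0. Qed.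

Lemma modulusV x : modulus x^-1 = (modulus x)^-1.
Proof.
move: x; rewrite /modulus; case: fld => x; first exact: normfV.
exact: ComplexField.Normc.normcV.
Qed.

Lemma modulusN x : modulus (- x) = modulus x.
Proof.
have -> : - x = scalar_of (-1) * x by rewrite scalar_ofN scalar_of1 mulN1r.
by rewrite modulusM modulus_scalar_of normrN1 mul1r.
Qed.

Lemma modulusD x y : modulus (x + y) <= modulus x + modulus y.
Proof.
move: x y; rewrite /modulus; case: fld => x y; first exact: ler_normD.
exact: le_normcD.
Qed.

Lemma modulus_sum N (f : nat -> scalars R fld) :
  modulus (\sum_(n < N) f n) <= \sum_(n < N) modulus (f n).
Proof.
elim: N => [|N IH]; first by rewrite !big_ord0 modulus0.
by rewrite !big_ord_recr/= (le_trans (modulusD _ _))// lerD2r.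
Qed.

(** Stated through the real-valued [modulus], so that one definition serves both fields. *)
Definition sums_to (f : nat -> scalars R fld) (l : scalars R fld) :=
  forall e : R, 0 < e -> exists N0, forall N, (N0 <= N)%N ->
    modulus (\sum_(n < N) f n - l) < e.

Lemma sums_to_unique f l1 l2 : sums_to f l1 -> sums_to f l2 -> l1 = l2.
Proof.
move=> h1 h2; apply/eqP; rewrite -subr_eq0; apply/eqP/modulus_eq0/eqP.
rewrite eq_le modulus_ge0 andbT; apply/ler_addgt0Pr => e e0; rewrite add0r.
have e2 : 0 < e / 2 by rewrite divr_gt0.
have [N1 /(_ (maxn N1 _) (leq_maxl _ _)) H1] := h1 _ e2.
have [N2 /(_ (maxn N1 _) (leq_maxr _ _)) H2] := h2 _ e2.
have {}H1 := H1 N2; set s := \sum_(n < _) _ in H1 H2.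
have -> : l1 - l2 = (s - l2) + - (s - l1) by ring.
have := modulusD (s - l2) (- (s - l1)); rewrite modulusN; lra.
Qed.

Lemma sums_toD c f g l m : sums_to f l -> sums_to g m ->
  sums_to (fun n => c * f n + g n) (c * l + m).
Proof.
(* The added 1 keeps the tolerance for [f] meaningful when c = 0. *)
move=> hf hg e e0; have c1 : 0 < 2 * (modulus c + 1) by have := modulus_ge0 c; lra.
have [N1 H1] := hf _ (divr_gt0 e0 c1).
have [N2 H2] := hg _ (divr_gt0 e0 (ltr0Sn R 1)).
exists (maxn N1 N2) => N; rewrite geq_max => /andP[/H1 {}H1 /H2 {}H2].
rewrite big_split/= -mulr_sumr.
set s := \sum_(n < N) f n in H1 *; set t := \sum_(n < N) g n in H2 *.
have -> : c * s + t - (c * l + m) = c * (s - l) + (t - m).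
  by rewrite mulrBr opprD addrACA.
apply: le_lt_trans (modulusD _ _) _; rewrite modulusM.
rewrite ltr_pdivlMr// in H1.
have := modulus_ge0 c; have := modulus_ge0 (s - l); nra.
Qed.

Lemma modulus_summable (f : nat -> scalars R fld) (S : R) :
  (forall N, \sum_(n < N) modulus (f n) <= S) -> exists l, sums_to f l.
Proof.
rewrite /sums_to /modulus; move: f; case: fld => /= f fS.
  exact: abs_summable fS.
exact: normc_summable fS.
Qed.

End scalars_theory.

(** * Finite values of nonnegative series *)

Section nneseries_fine.
Variables (R : realType) (f : nat -> R).
Hypothesis f0 : forall k, 0 <= f k.
Let sumf := (\sum_(0 <= k <oo) (f k)%:E)%E.

Lemma nneseries_fineE : (sumf < +oo)%E -> sumf = (fine sumf)%:E.
Proof.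
move=> h; symmetry; apply: fineK; rewrite ge0_fin_numE; first exact: h.
by apply: nneseries_ge0 => n _ _; rewrite lee_fin.
Qed.

Lemma sum_le_fine_nneseries (N : nat) : (sumf < +oo)%E ->
  \sum_(n < N) f n <= fine sumf.
Proof.
move=> /nneseries_fineE h; move: N; apply/(nneseries_leP _ f0).
by rewrite -h.
Qed.

Lemma fine_nneseries_near e : (sumf < +oo)%E -> 0 < e ->
  exists N : nat, fine sumf - e < \sum_(n < N) f n.
Proof.
move=> /nneseries_fineE h e0; apply: contrapT => /forallNP hN.
have : (sumf <= (fine sumf - e)%:E)%E.
  apply/(nneseries_leP _ f0) => N; rewrite leNgt; apply/negP; exact: hN.
by rewrite [X in (X <= _)%E]h lee_fin; lra.
Qed.

Lemma nneseries_bounded (S : R) : (forall N : nat, \sum_(n < N) f n <= S) ->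
  (sumf < +oo)%E /\ fine sumf <= S.
Proof.
move=> /(nneseries_leP _ f0) h.
have hoo : (sumf < +oo)%E by apply: le_lt_trans h (ltry _).
split; first exact: hoo.
by rewrite -lee_fin -nneseries_fineE.
Qed.

End nneseries_fine.

(** * The linear map defined by the matrix *)

Section weighted_map.
Variables (R : realType) (fld : base_field) (q : R) (m : nat -> nat -> R).
Variables (u v : scalar_seq R fld).
Local Notation mod x k := (@modulus R fld (x k)).
Hypothesis m0 : forall n k, 0 <= m n k.
Hypothesis mrow : forall n K, \sum_(k < K) m n k <= 1.
Hypothesis mcol : forall k N, \sum_(n < N) m n k <= 1.
Hypothesis mv : forall n K, \sum_(k < K) m n k * mod v k `^ q <= mod u n `^ q.

(** Where [u n = 0] the quotient is 0 by convention, so these terms drop out. *)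
Definition weighted_term (x : scalar_seq R fld) (k n : nat) : scalars R fld :=
  (v k : scalars R fld) * scalar_of fld (m n k) *
    ((x n : scalars R fld) / (u n : scalars R fld)).

(* The matrix [m] carries |v|^q to |u|^q; its transpose, conjugated by division
   by [u] and multiplication by [v], carries [u] to [v]. *)
Definition weighted_map (x : scalar_seq R fld) : scalar_seq R fld :=
  fun k => xget 0 [set l | sums_to (weighted_term x k) l]%classic.

Lemma modulus_weighted_term x k n :
  modulus (weighted_term x k n) = m n k * (mod v k * (mod x n / mod u n)).
Proof.
rewrite /weighted_term !modulusM modulusV modulus_scalar_of ger0_norm//.
by rewrite -mulrA mulrCA.
Qed.

Lemma weighted_mapP x k l : sums_to (weighted_term x k) l -> weighted_map x k = l.
Proof.
move=> h; suff hw : sums_to (weighted_term x k) (weighted_map x k).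
  exact: sums_to_unique hw h.
by apply: (xgetPex 0 (P := [set l | sums_to (weighted_term x k) l]%classic)); exists l.
Qed.

(** The estimate for finite sections, applied to moduli, gives absolute convergence of each
    coordinate and then, by semicontinuity, the bound for the limits. *)
Lemma weighted_map_bound (s S : R) (x : scalar_seq R fld) : 1 <= s -> s <= q ->
  (forall N, \sum_(n < N) mod x n `^ s <= S) ->
  (forall k, exists l, sums_to (weighted_term x k) l) /\
  (forall K, \sum_(k < K) mod (weighted_map x) k `^ s <= S).
Proof.
move=> s1 sq xS; have s0 : 0 < s by lra.
have core K N : \sum_(k < K) (\sum_(n < N) modulus (weighted_term x k n)) `^ s <= S.
  under eq_bigr do under eq_bigr do rewrite modulus_weighted_term.
  apply: le_trans (xS N); apply: (@substochastic_powR_le R m (fun n => mod u n)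
    (fun k => mod v k) (fun n => mod x n) s q N K) => // n; exact: modulus_ge0.
have t0 k N : 0 <= \sum_(n < N) modulus (weighted_term x k n).
  by apply: sumr_ge0 => n _; exact: modulus_ge0.
have conv k : exists l, sums_to (weighted_term x k) l.
  apply: (@modulus_summable R fld _ (S `^ s^-1)) => N.
  have : (\sum_(n < N) modulus (weighted_term x k n)) `^ s <= S.
    apply: le_trans (core k.+1 N); rewrite big_ord_recr/= lerDr sumr_ge0// => j _.
    exact: powR_ge0.
  move=> h; have := @ge0_ler_powR R s^-1 _ _ _ _ _ h.
  rewrite invr_ge0 (ltW s0) !nnegrE powR_ge0 (le_trans (powR_ge0 _ _) h).
  move=> /(_ isT isT isT); rewrite -powRrM divff ?gt_eqF// powRr1//.
split=> // K; apply: (@powR_sum_lsc R s S K (fun k => mod (weighted_map x) k)) => //.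
  by move=> k; exact: modulus_ge0.
move=> e e0.
(* One truncation is close to the limit in all of the first K coordinates. *)
have [N hN] : exists N, forall k, (k < K)%N ->
    modulus (\sum_(n < N) weighted_term x k n - weighted_map x k) < e.
  suff [N0 h] : exists N0, forall N k, (N0 <= N)%N -> (k < K)%N ->
      modulus (\sum_(n < N) weighted_term x k n - weighted_map x k) < e.
    by exists N0 => k; exact: h.
  elim: (K) => [|K' [N0 h0]]; first by exists 0%N.
  have [l hl] := conv K'; have [N1 h1] := hl _ e0.
  exists (maxn N0 N1) => N k; rewrite geq_max => /andP[H0 H1].
  rewrite ltnS leq_eqVlt => /predU1P[->|kK]; last exact: h0.
  by rewrite (weighted_mapP hl); exact: h1.
exists (fun k => \sum_(n < N) modulus (weighted_term x k n)); split => //.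
move=> k /hN; set t := \sum_(n < N) weighted_term x k n.
have : modulus t <= \sum_(n < N) modulus (weighted_term x k n).
  exact: modulus_sum.
have := modulusD t (- (t - weighted_map x k)); rewrite modulusN opprB addrC subrK.
lra.
Qed.

(** Convergence is assumed because divergent series receive the default value 0, which is not
    linear. It holds on the sum space, where [L1] asks for linearity. *)
Lemma weighted_map_linear c (x y : scalar_seq R fld) :
  (forall k, exists l, sums_to (weighted_term x k) l) ->
  (forall k, exists l, sums_to (weighted_term y k) l) ->
  (forall k, exists l, sums_to (weighted_term (c *: x + y) k) l) /\
  weighted_map (c *: x + y) = c *: weighted_map x + weighted_map y.
Proof.
move=> cx cy.
have H k l l' : sums_to (weighted_term x k) l -> sums_to (weighted_term y k) l' ->
    sums_to (weighted_term (c *: x + y) k) (c * l + l').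
  move=> hl hl'; have := sums_toD c hl hl'; congr sums_to; apply/funext => n.
  rewrite /weighted_term.
  have -> : (c *: x + y) n = c * (x n : scalars R fld) + (y n : scalars R fld) by [].
  by ring.
split=> [k|]; first by have [l hl] := cx k; have [l' hl'] := cy k; exists (c * l + l'); exact: H.
apply/funext => k; have [l hl] := cx k; have [l' hl'] := cy k.
rewrite (weighted_mapP (H _ _ _ hl hl')).
have -> : (c *: weighted_map x + weighted_map y) k =
  c * (weighted_map x k : scalars R fld) + (weighted_map y k : scalars R fld) by [].
by rewrite (weighted_mapP hl) (weighted_mapP hl').
Qed.

Lemma weighted_map_contracts s : 1 <= s -> s <= q ->
  contracts weighted_map 1 (@ell R fld s).
Proof.
move=> s1 sq x hx; have p0 (z : scalar_seq R fld) k : 0 <= mod z k `^ s.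
  exact: powR_ge0.
have xS N := sum_le_fine_nneseries (p0 x) N hx.
have [_ h] := weighted_map_bound s1 sq xS.
have [h1 h2] := nneseries_bounded (p0 (weighted_map x)) h.
split; first exact: h1.
have s0 : 0 <= s^-1 by rewrite invr_ge0; lra.
rewrite mul1r /=; apply: ge0_ler_powR; [exact: s0| | |exact: h2].
(* The empty partial sum shows that the total is nonnegative. *)
- rewrite nnegrE; have := sum_le_fine_nneseries (p0 (weighted_map x)) 0 h1.
  by rewrite big_ord0.
- by rewrite nnegrE; have := xS 0%N; rewrite big_ord0.
Qed.

Lemma ell_converges s (x : scalar_seq R fld) : 1 <= s -> s <= q ->
  carrier (ell s) x -> forall k, exists l, sums_to (weighted_term x k) l.
Proof.
move=> s1 sq hx; have p0 k : 0 <= mod x k `^ s by exact: powR_ge0.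
have xS N := sum_le_fine_nneseries p0 N hx.
by have [] := weighted_map_bound s1 sq xS.
Qed.

Lemma weighted_map_L1 p : 1 <= p -> p < q ->
  L1 (@ell R fld p) (@ell R fld q) weighted_map.
Proof.
move=> p1 pq; have q1 : 1 <= q by lra.
have conv x : sum_space (@ell R fld p) (@ell R fld q) x ->
    forall k, exists l, sums_to (weighted_term x k) l.
  move=> [x0 hx0 [x1 hx1 <-]]; rewrite -[x0]scale1r.
  by have [] := weighted_map_linear 1 (ell_converges p1 (ltW pq) hx0)
    (ell_converges q1 (lexx q) hx1).
split.
- move=> _ [x0 hx0 [x1 hx1 <-]]; rewrite -[x0]scale1r.
  have [_ ->] := weighted_map_linear 1 (ell_converges p1 (ltW pq) hx0)
    (ell_converges q1 (lexx q) hx1).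
  exists (weighted_map x0); first exact: (weighted_map_contracts p1 (ltW pq) hx0).1.
  exists (weighted_map x1); first exact: (weighted_map_contracts q1 (lexx q) hx1).1.
  by rewrite scale1r.
- by move=> c x y /conv cx /conv cy; have [] := weighted_map_linear c cx cy.
- exact: weighted_map_contracts p1 (ltW pq).
- exact: weighted_map_contracts q1 (lexx q).
Qed.

(** Each quotient u_n/u_n is 1 or meets a zero row, so coordinate k is v_k times the k-th column
    sum, which tends to 1 unless v_k = 0. *)
Lemma weighted_map_eq :
  (forall n k, mod u n = 0 -> m n k = 0) ->
  (forall k e, 0 < mod v k -> 0 < e -> exists N0, forall N, (N0 <= N)%N ->
     1 - e < \sum_(n < N) m n k) ->
  weighted_map u = v.
Proof.
move=> mu mv1; apply/funext => k; apply: weighted_mapP => e e0.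
have sumE N : \sum_(n < N) weighted_term u k n - v k =
    (v k : scalars R fld) * scalar_of fld (\sum_(n < N) m n k - 1).
  rewrite scalar_ofD scalar_ofN scalar_of1 mulrBr mulr1 (scalar_of_sum fld N (fun n => m n k)) mulr_sumr.
  congr (_ - _); apply: eq_bigr => n _; rewrite /weighted_term.
  have [un|un] := eqVneq (u n : scalars R fld) 0.
    by rewrite mu ?un ?modulus0// scalar_of0 mulr0 mul0r.
  by rewrite divff// mulr1.
have [v0|v0] := eqVneq (mod v k) 0.
  by exists 0%N => N _; rewrite sumE modulusM v0 mul0r.
have vk : 0 < mod v k by rewrite lt_neqAle eq_sym v0 modulus_ge0.
have [N0 h] := mv1 k _ vk (divr_gt0 e0 vk).
exists N0 => N /h hN; rewrite sumE modulusM modulus_scalar_of mulrC -ltr_pdivlMr//.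
by rewrite ler0_norm ?subr_le0 ?mcol//; lra.
Qed.

End weighted_map.

(** * Application of the interpolation property *)

Theorem theorem4p1 (R : realType) (fld : base_field) (p q C : R)
    (E : normed_data (scalar_seq R fld)) :
  1 <= p -> p < q -> 0 < C ->
  normed_interpolation_space C (ell p) (ell q) E ->
  property_S q C E.
Proof.
move=> p1 pq C0 [_ _ _ HE] u v hu hv partial_le total_eq Eu.
have q0 : 0 < q by lra.
have pu k : 0 <= @modulus R fld (u k) `^ q by exact: powR_ge0.
have pv k : 0 <= @modulus R fld (v k) `^ q by exact: powR_ge0.
have au N := sum_le_fine_nneseries pu N hu.
have bv N := sum_le_fine_nneseries pv N hv.
have near_u e := fine_nneseries_near pu (e := e) hu.
(* The equality of the extended-real totals becomes a statement about bounds of partial sums. *)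
have total_ge S : (forall N : nat, \sum_(n < N) rearrangement u n `^ q <= S) ->
    forall N : nat, \sum_(n < N) rearrangement v n `^ q <= S.
  have pr (w : scalar_seq R fld) k : 0 <= rearrangement w k `^ q by exact: powR_ge0.
  by move=> /(nneseries_leP _ (pr u)); rewrite total_eq => /(nneseries_leP _ (pr v)).
have [m [m0 mrow mcol mv [mu mv1]]] := majorization_matrix q0
  (fun k => @modulus_ge0 R fld (u k)) (fun k => @modulus_ge0 R fld (v k))
  au near_u bv partial_le total_ge.
have := HE _ (weighted_map_L1 m0 mrow mcol mv p1 pq) _ Eu.
by rewrite (weighted_map_eq mcol mu mv1).
Qed.
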